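(* Consider the many-body integrator $$\bm q_{A\,n+1}-\bm q_{A\,n}=\Delta t_n\sum_{B=1}^N m^{-1}_{AB}\,\bm p^B_{n+\frac12},\qquad \bm p^A_{n+1}-\bm p^A_n=-\sum_{B\ne A}\bm f^{AB}_{\square},\qquad A=1,\dots,N,$$ with algorithmic force $\bm f^{AB}_\square$ chosen as one of $\bm f^{AB}_{\mathrm{lg}},\bm f^{AB}_{\mathrm{ge}},\bm f^{AB}_{\mathrm{pm}},\bm f^{AB}_{\mathrm{pt}}$ defined in the context, and let $(\bm q_{n+1},\bm p_{n+1})$ solve the step from $(\bm q_n,\bm p_n)$. (1) For the LaBudde-Greenspan integrator ($\bm f_{\mathrm{lg}}$): $H(\bm q_{n+1},\bm p_{n+1})=H(\bm q_n,\bm p_n)$. (2) For the generalized Eyre integrator ($\bm f_{\mathrm{ge}}$): $H(\bm q_{n+1},\bm p_{n+1})=H(\bm q_n,\bm p_n)-\mathcal D_{\mathrm{ge}}$, where for some $\xi_1,\xi_2\in(0,1)$ $$\mathcal D_{\mathrm{ge}}=\frac14\sum_{A=1}^N\sum_{B\neq A}(d_{AB\,n+1}-d_{AB\,n})^2\left(\hat V_{AB\,\mathrm c}''(d_{AB\,n+\xi_1})-\hat V_{AB\,\mathrm e}''(d_{AB\,n+\xi_2})\right)\ge0.$$ (3) For the perturbed mid-point integrator ($\bm f_{\mathrm{pm}}$): $H(\bm q_{n+1},\bm p_{n+1})=H(\bm q_n,\bm p_n)-\mathcal D_{\mathrm{pm}}$, where for some $\xi_3,\xi_4\in(0,1)$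 $$\mathcal D_{\mathrm{pm}}=\frac1{96}\sum_{A=1}^N\sum_{B\neq A}(d_{AB\,n+1}-d_{AB\,n})^4\left(\hat V_{AB+}^{(4)}(d_{AB\,n+\xi_3})-\hat V_{AB-}^{(4)}(d_{AB\,n+\xi_4})\right)\ge0.$$ (4) For the perturbed trapezoidal integrator ($\bm f_{\mathrm{pt}}$): $H(\bm q_{n+1},\bm p_{n+1})=H(\bm q_n,\bm p_n)-\mathcal D_{\mathrm{pt}}$, where for some $\xi_5,\xi_6\in(0,1)$ $$\mathcal D_{\mathrm{pt}}=\frac1{48}\sum_{A=1}^N\sum_{B\neq A}(d_{AB\,n+1}-d_{AB\,n})^4\left(\hat V_{AB+}^{(4)}(d_{AB\,n+\xi_5})-\hat V_{AB-}^{(4)}(d_{AB\,n+\xi_6})\right)\ge0.$$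
   Context: There are $N$ particles with positions $\bm q_A\in\mathbb R^3$ and momenta $\bm p^A\in\mathbb R^3$; $\bm q=(\bm q_1,\dots,\bm q_N)$, $\bm p=(\bm p^1,\dots,\bm p^N)$. The mass matrix $(m^{AB})_{A,B=1}^N$ is a constant real symmetric positive definite matrix and $m^{-1}_{AB}$ are the entries of its inverse. $\Delta t_n>0$. Pair potentials $\hat V_{AB}:(0,\infty)\to\mathbb R$ for $A\neq B$ satisfy $\hat V_{AB}=\hat V_{BA}$, and are split, symmetrically in $A,B$, as $\hat V_{AB}=\hat V_{AB\,\mathrm c}+\hat V_{AB\,\mathrm e}$ (twice differentiable, $\hat V_{AB\,\mathrm c}''\ge0$, $\hat V_{AB\,\mathrm e}''\le0$) and as $\hat V_{AB}=\hat V_{AB+}+\hat V_{AB-}$ (four times differentiable, $\hat V_{AB+}^{(4)}\ge0$, $\hat V_{AB-}^{(4)}\le0$). The Hamiltonian is $H(\bm q,\bm p)=K(\bm p)+V(\bm q)$ with $K(\bm p)=\frac12\sum_{A,B=1}^N m^{-1}_{AB}\,\bm p^A\cdot\bm p^B$ and $V(\bm q)=\frac12\sum_{A=1}^N\sum_{B\ne A}\hat V_{AB}(\|\bm q_A-\bm q_B\|)$. Notation: $\bm q_{A\,n+\frac12}:=\frac12(\bm q_{A\,n}+\bm q_{A\,n+1})$, $\bm p^A_{n+\frac12}:=\frac12(\bm p^A_n+\bm p^A_{n+1})$, $d_{AB\,n}:=\|\bm q_{A\,n}-\bm q_{B\,n}\|$, $d_{AB\,n+1}:=\|\bm q_{A\,n+1}-\bm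 q_{B\,n+1}\|$, and $d_{AB\,n+\alpha}:=(1-\alpha)d_{AB\,n}+\alpha d_{AB\,n+1}$ for $\alpha\in[0,1]$. Abbreviate $d=d_{AB\,n}$, $d'=d_{AB\,n+1}$, $\bm e_{AB}:=\bm q_{A\,n+\frac12}-\bm q_{B\,n+\frac12}$. The algorithmic forces are $$\bm f^{AB}_{\mathrm{lg}}:=2\Delta t_n\frac{\hat V_{AB}(d')-\hat V_{AB}(d)}{d'-d}\,\frac{\bm e_{AB}}{d'+d},\qquad \bm f^{AB}_{\mathrm{ge}}:=2\Delta t_n\left(\hat V_{AB\,\mathrm c}'(d')+\hat V_{AB\,\mathrm e}'(d)\right)\frac{\bm e_{AB}}{d'+d},$$ $$\bm f^{AB}_{\mathrm{pm}}:=2\Delta t_n\left(\hat V_{AB}'\left(\tfrac{d'+d}{2}\right)+\frac{(d'-d)^2}{24}\left(\hat V_{AB+}'''(d')+\hat V_{AB-}'''(d)\right)\right)\frac{\bm e_{AB}}{d'+d},$$ $$\bm f^{AB}_{\mathrm{pt}}:=2\Delta t_n\left(\frac{\hat V_{AB}'(d')+\hat V_{AB}'(d)}{2}-\frac{(d'-d)^2}{12}\left(\hat V_{AB+}'''(d)+\hat V_{AB-}'''(d')\right)\right)\frac{\bm e_{AB}}{d'+d}.$$ It is understood that all these expressions are well defined, i.e. $d_{AB\,n},d_{AB\,n+1}>0$ for all $A\ne B$, and additionally $d_{AB\,n+1}\neq d_{AB\,n}$ for the LaBudde-Greenspan integrator. *)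

(* Defs.v *)
From HB Require Import structures.
From mathcomp Require Export all_boot all_order all_algebra.
From mathcomp Require Export all_classical all_reals all_analysis.

Set Implicit Arguments.
Unset Strict Implicit.
Unset Printing Implicit Defensive.

Export Order.TTheory GRing.Theory Num.Theory.
Export numFieldNormedType.Exports.

#[global] Open Scope ring_scope.

(* The library norm on row vectors is the sup norm, hence an explicit Euclidean
   inner product and norm. *)
Definition dotv (R : realType) (k : nat) (u v : 'rV[R]_k) : R :=
  \sum_(i < k) u 0 i * v 0 i.

Definition enorm (R : realType) (k : nat) (u : 'rV[R]_k) : R :=
  Num.sqrt (dotv u u).

Definition posdefmx (R : realType) (N : nat) (m : 'M[R]_N) : Prop :=
  m^T = m /\ forall x : 'rV[R]_N, x != 0 -> 0 < (x *m m *m x^T) 0 0.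

(* A function on (0, oo) is represented by a total function whose values on
   (-oo, 0] are irrelevant.  The iterated two-sided derivatives at r > 0
   only depend on the restriction of f to (0, oo). *)
Definition times_differentiable (R : realType) (k : nat) (f : R -> R) : Prop :=
  forall (j : nat) (r : R), (j < k)%N -> 0 < r -> derivable (derive1n j f) r 1.

(* The value of a configuration or of the momenta at one time is a family of
   vectors of R^3; x and x' are the values at the start and end of the step. *)
Definition particles (R : realType) (N : nat) : Type := 'I_N -> 'rV[R]_3.

(* The entries at A = B of a family of pair potentials are never used. *)
Definition pair_potentials (R : realType) (N : nat) : Type :=
  'I_N -> 'I_N -> R -> R.

Definition pair_symmetric (R : realType) (N : nat)
    (V : pair_potentials R N) : Prop :=
  forall (A B : 'I_N) (r : R), A != B -> 0 < r -> V A B r = V B A r.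

Definition splits_as (R : realType) (N : nat)
    (V V1 V2 : pair_potentials R N) : Prop :=
  forall (A B : 'I_N) (r : R), A != B -> 0 < r -> V A B r = V1 A B r + V2 A B r.

Definition midpt (R : realType) (N : nat) (x x' : particles R N)
    (A : 'I_N) : 'rV[R]_3 :=
  2^-1 *: (x A + x' A).

Definition dist (R : realType) (N : nat) (q : particles R N)
    (A B : 'I_N) : R :=
  enorm (q A - q B).

Definition dist_at (R : realType) (N : nat) (q q' : particles R N)
    (A B : 'I_N) (alpha : R) : R :=
  (1 - alpha) * dist q A B + alpha * dist q' A B.

Definition kinetic (R : realType) (N : nat) (m : 'M[R]_N)
    (p : particles R N) : R :=
  2^-1 * \sum_(A < N) \sum_(B < N) invmx m A B * dotv (p A) (p B).

Definition potential (R : realType) (N : nat) (V : pair_potentials R N)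
    (q : particles R N) : R :=
  2^-1 * \sum_(A < N) \sum_(B < N | B != A) V A B (dist q A B).

Definition hamiltonian (R : realType) (N : nat) (m : 'M[R]_N)
    (V : pair_potentials R N) (q p : particles R N) : R :=
  kinetic m p + potential V q.

(* The common shape of the four algorithmic forces, which differ only in the
   scalar c approximating the derivative of the pair potential. *)
Definition pair_force (R : realType) (N : nat) (dt c : R)
    (q q' : particles R N) (A B : 'I_N) : 'rV[R]_3 :=
  (2 * dt * c) *:
    ((dist q' A B + dist q A B)^-1 *: (midpt q q' A - midpt q q' B)).

Definition force_lg (R : realType) (N : nat) (dt : R)
    (V : pair_potentials R N) (q q' : particles R N)
    (A B : 'I_N) : 'rV[R]_3 :=
  let d := dist q A B in let d' := dist q' A B in
  pair_force dt ((V A B d' - V A B d) / (d' - d)) q q' A B.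

Definition force_ge (R : realType) (N : nat) (dt : R)
    (Vc Ve : pair_potentials R N) (q q' : particles R N)
    (A B : 'I_N) : 'rV[R]_3 :=
  let d := dist q A B in let d' := dist q' A B in
  pair_force dt (derive1 (Vc A B) d' + derive1 (Ve A B) d) q q' A B.

Definition force_pm (R : realType) (N : nat) (dt : R)
    (V Vp Vm : pair_potentials R N) (q q' : particles R N)
    (A B : 'I_N) : 'rV[R]_3 :=
  let d := dist q A B in let d' := dist q' A B in
  pair_force dt
    (derive1 (V A B) ((d' + d) / 2) +
     (d' - d) ^+ 2 / 24 *
       (derive1n 3 (Vp A B) d' + derive1n 3 (Vm A B) d))
    q q' A B.

Definition force_pt (R : realType) (N : nat) (dt : R)
    (V Vp Vm : pair_potentials R N) (q q' : particles R N)
    (A B : 'I_N) : 'rV[R]_3 :=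
  let d := dist q A B in let d' := dist q' A B in
  pair_force dt
    ((derive1 (V A B) d' + derive1 (V A B) d) / 2 -
     (d' - d) ^+ 2 / 12 *
       (derive1n 3 (Vp A B) d + derive1n 3 (Vm A B) d'))
    q q' A B.

Definition solves_step (R : realType) (N : nat) (m : 'M[R]_N) (dt : R)
    (force : 'I_N -> 'I_N -> 'rV[R]_3) (q p q' p' : particles R N) : Prop :=
  forall A : 'I_N,
    q' A - q A = dt *: \sum_(B < N) invmx m A B *: midpt p p' B /\
    p' A - p A = - \sum_(B < N | B != A) force A B.

Definition dissip_ge (R : realType) (N : nat) (Vc Ve : pair_potentials R N)
    (q q' : particles R N) (xi1 xi2 : R) : R :=
  4^-1 * \sum_(A < N) \sum_(B < N | B != A)
    (dist q' A B - dist q A B) ^+ 2 *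
    (derive1n 2 (Vc A B) (dist_at q q' A B xi1) -
     derive1n 2 (Ve A B) (dist_at q q' A B xi2)).

Definition dissip_pm (R : realType) (N : nat) (Vp Vm : pair_potentials R N)
    (q q' : particles R N) (xi3 xi4 : R) : R :=
  96^-1 * \sum_(A < N) \sum_(B < N | B != A)
    (dist q' A B - dist q A B) ^+ 4 *
    (derive1n 4 (Vp A B) (dist_at q q' A B xi3) -
     derive1n 4 (Vm A B) (dist_at q q' A B xi4)).

Definition dissip_pt (R : realType) (N : nat) (Vp Vm : pair_potentials R N)
    (q q' : particles R N) (xi5 xi6 : R) : R :=
  48^-1 * \sum_(A < N) \sum_(B < N | B != A)
    (dist q' A B - dist q A B) ^+ 4 *
    (derive1n 4 (Vp A B) (dist_at q q' A B xi5) -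
     derive1n 4 (Vm A B) (dist_at q q' A B xi6)).

(* Main.v *)
(* Since every pair force is antisymmetric and directed along the midpoint
   separation, whose product with the increment of the separation is half the
   increment of the squared distance, the kinetic energy changes by exactly
   -1/2 sum c_AB (d' - d), with c_AB the scalar that approximates the derivative
   of the pair potential.  The change of H is thus the error of a quadrature
   rule for the increment of the potential.  To obtain parameters xi common to
   all pairs, the remainder formulas are applied not to each pair but to the
   single function of alpha in [0, 1] that sums all pair potentials at the
   interpolated distances d_(AB n + alpha).  The fourth derivatives need not be
   continuous, so these formulas are proved by repeated use of Rolle's theorem
   after symmetrization about 1/2. *)
From mathcomp Require Import ring lra.
Require Import Defs.

Set Implicit Arguments.
Unset Strict Implicit.
Unset Printing Implicit Defensive.

(** * Remainders of Taylor and quadrature formulas on [0, 1] *)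

Section TaylorOnUnitInterval.
Variable R : realType.
Implicit Types (f g : R -> R) (F : nat -> R -> R).

Lemma is_derive_affine f (a b x df : R) :
  is_derive (a + b * x) 1 f df ->
  is_derive x 1 (fun s => f (a + b * s)) (b * df).
Proof.
move=> fE; pose g : R -> R := cst a + b *: (@id R).
have gE : is_derive x 1 g (0 + b *: 1) by exact: is_deriveD.
have := @is_derive1_comp R f g x df _ fE gE.
by rewrite add0r /GRing.scale /= mulr1 mulrC.
Qed.

Lemma is_derive_continuous f f' (a b : R) :
  (forall x : R, a <= x <= b -> is_derive x 1 f (f' x)) ->
  {within `[a, b], continuous f}%classic.
Proof.
move=> fE; apply: derivable_within_continuous => x.
by rewrite in_itv /= => /fE[].
Qed.

Lemma rolle f f' (a b : R) : a < b ->
  (forall x : R, a <= x <= b -> is_derive x 1 f (f' x)) -> f a = f b ->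
  exists2 c, a < c < b & f' c = 0.
Proof.
move=> ab fE fab; have [x|c] := Rolle ab _ (is_derive_continuous fE) fab.
  by rewrite in_itv /= => /andP[ax xb]; have [] // : is_derive x 1 f (f' x);
    apply: fE; rewrite !ltW.
rewrite in_itv /= => acb f0; exists c => //.
have f'c : is_derive c 1 f (f' c).
  by apply: fE; case/andP: acb => *; rewrite !ltW.
by rewrite -(@derive_val _ _ _ _ _ _ _ f'c) (@derive_val _ _ _ _ _ _ _ f0).
Qed.

(** The derivatives at 0 and 1 are two-sided as well, and the top level [F k] may be
    discontinuous. *)
Definition derivative_tower (k : nat) F : Prop :=
  forall (j : nat) (x : R), (j < k)%N -> 0 <= x <= 1 ->
    is_derive x 1 (F j) (F j.+1 x).

(** Substituting 1 - x for x swaps the endpoints at the cost of one sign per derivative. This turns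
    each remainder formula with a derivative correction at 0 into the one with the correction at
    1. *)
Lemma derivative_tower_reflect k F : derivative_tower k F ->
  derivative_tower k (fun j x => (-1) ^+ j * F j (1 - x)).
Proof.
move=> FE j x jk x01.
have Fj : is_derive (1 + -1 * x) 1 (F j) (F j.+1 (1 - x)).
  by rewrite mulN1r; apply: FE => //; lra.
have -> : (fun x => (-1) ^+ j * F j (1 - x)) =
    (-1) ^+ j *: (fun x => F j (1 + -1 * x)).
  by apply/funext => y; rewrite /GRing.scale /= mulN1r.
have Fj' := is_derive_affine Fj.
by apply: is_derive_eq; rewrite /GRing.scale /= exprS; ring.
Qed.

Lemma taylor2 F : derivative_tower 2 F ->
  exists2 xi, 0 < xi < 1 & F 0%N 1 - F 0%N 0 - F 1%N 0 = F 2%N xi / 2.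
Proof.
move=> FE; pose k := F 0%N 1 - F 0%N 0 - F 1%N 0.
(* The constant [k] makes [G] agree at 0 and 1. Since also [G1 0 = 0], the zero of [G1] found by
   Rolle allows a second use of Rolle. *)
pose G (x : R) := F 0%N x - F 1%N 0 * x - k * x ^+ 2.
pose G1 (x : R) := F 1%N x - F 1%N 0 - k * 2 * x.
have GE (x : R) : 0 <= x <= 1 -> is_derive x 1 G (G1 x).
  move=> x01; have F0 := FE 0%N x isT x01.
  apply: (@is_derive_eq _ _ _ (F 0%N - F 1%N 0 *: id - k *: id ^+ 2)).
  by rewrite /G1 /GRing.scale /=; ring.
have G1E (x : R) : 0 <= x <= 1 -> is_derive x 1 G1 (F 2%N x - k * 2).
  move=> x01; have F1 := FE 1%N x isT x01.
  apply: (@is_derive_eq _ _ _ (F 1%N - cst (F 1%N 0) - (k * 2) *: id)).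
  by rewrite /GRing.scale /=; ring.
have [||c c01 G1c] := @rolle G G1 0 1 _ GE; [lra| by rewrite /G/k; ring|].
have [|x||xi xic] := @rolle G1 (fun x => F 2%N x - k * 2) 0 c; first lra.
- by move=> x0c; apply: G1E; lra.
- by rewrite G1c /G1; ring.
by move=> F2; exists xi; [lra|rewrite -/k; lra].
Qed.

Lemma taylor2_reflect F : derivative_tower 2 F ->
  exists2 xi, 0 < xi < 1 & F 0%N 1 - F 0%N 0 - F 1%N 1 = - (F 2%N xi / 2).
Proof.
move=> /derivative_tower_reflect/taylor2[xi xi01].
rewrite !expr0 expr1 expr2 subr0 subrr => FE; exists (1 - xi); lra.
Qed.

(** Together with [even_half]: twice the odd and even parts of [f] about 1/2. Differentiation
    exchanges them, and odd parts vanish at 0, which gives Rolle one of its two zeros. *)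
Definition odd_half f (s : R) := f (2^-1 + s) - f (2^-1 - s).
Definition even_half f (s : R) := f (2^-1 + s) + f (2^-1 - s).

Lemma is_derive_right_half f f' (s : R) :
  (forall x : R, 0 <= x <= 1 -> is_derive x 1 f (f' x)) ->
  0 <= s <= 2^-1 -> is_derive s 1 (fun s => f (2^-1 + s)) (f' (2^-1 + s)).
Proof.
move=> fE s0h.
have -> : (fun s => f (2^-1 + s)) = (fun s => f (2^-1 + 1 * s)).
  by apply/funext => t; rewrite mul1r.
rewrite -[f' _]mul1r; apply: is_derive_affine; rewrite mul1r.
by apply: fE; lra.
Qed.

Lemma is_derive_left_half f f' (s : R) :
  (forall x : R, 0 <= x <= 1 -> is_derive x 1 f (f' x)) ->
  0 <= s <= 2^-1 -> is_derive s 1 (fun s => f (2^-1 - s)) (- f' (2^-1 - s)).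
Proof.
move=> fE s0h.
have -> : (fun s => f (2^-1 - s)) = (fun s => f (2^-1 + -1 * s)).
  by apply/funext => t; rewrite mulN1r.
rewrite -[- f' _]mulN1r; apply: is_derive_affine; rewrite mulN1r.
by apply: fE; lra.
Qed.

Lemma is_derive_odd_half f f' (s : R) :
  (forall x : R, 0 <= x <= 1 -> is_derive x 1 f (f' x)) ->
  0 <= s <= 2^-1 -> is_derive s 1 (odd_half f) (even_half f' s).
Proof.
move=> fE s0h; have r := is_derive_right_half fE s0h.
have l := is_derive_left_half fE s0h.
by apply: (is_derive_eq (is_deriveB r l)); rewrite opprK.
Qed.

Lemma is_derive_even_half f f' (s : R) :
  (forall x : R, 0 <= x <= 1 -> is_derive x 1 f (f' x)) ->
  0 <= s <= 2^-1 -> is_derive s 1 (even_half f) (odd_half f' s).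
Proof.
move=> fE s0h; have r := is_derive_right_half fE s0h.
have l := is_derive_left_half fE s0h.
exact: (is_deriveD r l).
Qed.

(* The left-hand side equals (2^-1 + s) * c1 + (2^-1 - s) * c2, where c1 and c2
   are difference quotients of g based at 0, and these take every intermediate
   value. *)
Lemma even_half_mean g g' (s : R) :
  (forall x : R, 0 <= x <= 1 -> is_derive x 1 g (g' x)) -> 0 < s < 2^-1 ->
  exists2 xi, 0 < xi < 1 & even_half g s - 2 * g 0 = g' xi.
Proof.
move=> gE s0h; pose v := even_half g s - 2 * g 0.
pose k (x : R) := g x - g 0 - v * x.
have kE (x : R) : 0 <= x <= 1 -> is_derive x 1 k (g' x - v).
  move=> x01; have g'x := gE x x01.
  apply: (@is_derive_eq _ _ _ (g - cst (g 0) - v *: id)).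
  by rewrite /GRing.scale /=; ring.
(* By the choice of [v], [k] takes opposite values at 1/2 - s and 1/2 + s, so it vanishes at some t
   between them. Here t > 0 because s < 1/2, and [k 0 = 0] is the second zero for Rolle. *)
have ks : k (2^-1 + s) = - k (2^-1 - s) by rewrite /k /v /even_half; field.
have [|||t] := @IVT R k (2^-1 - s) (2^-1 + s) 0; first lra.
- by apply: is_derive_continuous => x xs; apply: kE; lra.
- by rewrite ks ge_min le_max; case: (lerP 0 (k (2^-1 - s))) => ?; lra.
rewrite in_itv /= => tI kt.
have [|x||xi xi0t k'xi] := @rolle k (fun x => g' x - v) 0 t; first lra.
- by move=> xt; apply: kE; lra.
- by rewrite kt /k; ring.
by exists xi; rewrite -?/v; lra.
Qed.

(** The cubic term 8 k s^3 equals k at s = 1/2, so that [G] vanishes there. As [G], [G1] and [G2]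
    vanish at 0, Rolle applies three times and makes [even_half] of the third derivative equal to 48
    k at some [s3]; [even_half_mean] then brings in the fourth derivative. *)
Lemma midpoint_error F : derivative_tower 4 F ->
  exists2 xi, 0 < xi < 1 &
    F 0%N 1 - F 0%N 0 - F 1%N 2^-1 - F 3%N 0 / 24 = F 4%N xi / 48.
Proof.
move=> FE; pose k := F 0%N 1 - F 0%N 0 - F 1%N 2^-1.
pose G (s : R) := odd_half (F 0%N) s - 2 * F 1%N 2^-1 * s - 8 * k * s ^+ 3.
pose G1 (s : R) := even_half (F 1%N) s - 2 * F 1%N 2^-1 - 24 * k * s ^+ 2.
pose G2 (s : R) := odd_half (F 2%N) s - 48 * k * s.
pose G3 (s : R) := even_half (F 3%N) s - 48 * k.
have GE (s : R) : 0 <= s <= 2^-1 -> is_derive s 1 G (G1 s).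
  move=> s0h; have F0 := is_derive_odd_half (fun x => FE 0%N x isT) s0h.
  apply: (@is_derive_eq _ _ _ (odd_half (F 0%N) - (2 * F 1%N 2^-1) *: id
    - (8 * k) *: id ^+ 3)).
  by rewrite /G1 /GRing.scale /=; ring.
have G1E (s : R) : 0 <= s <= 2^-1 -> is_derive s 1 G1 (G2 s).
  move=> s0h; have F1 := is_derive_even_half (fun x => FE 1%N x isT) s0h.
  apply: (@is_derive_eq _ _ _ (even_half (F 1%N) - cst (2 * F 1%N 2^-1)
    - (24 * k) *: id ^+ 2)).
  by rewrite /G2 /GRing.scale /=; ring.
have G2E (s : R) : 0 <= s <= 2^-1 -> is_derive s 1 G2 (G3 s).
  move=> s0h; have F2 := is_derive_odd_half (fun x => FE 2%N x isT) s0h.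
  apply: (@is_derive_eq _ _ _ (odd_half (F 2%N) - (48 * k) *: id)).
  by rewrite /G3 /GRing.scale /=; ring.
have hh : 2^-1 + 2^-1 = 1 :> R by field.
have [||s1 s1I G1s1] := @rolle G G1 0 2^-1 _ GE; first lra.
  by rewrite /G /odd_half hh addr0 subrr subr0 /k; field.
have [|x||s2 s2I G2s2] := @rolle G1 G2 0 s1; first lra.
- by move=> xs1; apply: G1E; lra.
- by rewrite G1s1 /G1 /even_half addr0 subr0; ring.
have [|x||s3 s3I G3s3] := @rolle G2 G3 0 s2; first lra.
- by move=> xs2; apply: G2E; lra.
- by rewrite G2s2 /G2 /odd_half addr0 subr0; ring.
have [|xi xi01 F4] := @even_half_mean _ _ s3 (fun x => FE 3%N x isT); first lra.
by exists xi => //; rewrite -/k -F4; move: G3s3; rewrite /G3; lra.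
Qed.

Lemma midpoint_error_reflect F : derivative_tower 4 F ->
  exists2 xi, 0 < xi < 1 &
    F 0%N 1 - F 0%N 0 - F 1%N 2^-1 - F 3%N 1 / 24 = - (F 4%N xi / 48).
Proof.
move=> /derivative_tower_reflect/midpoint_error[xi xi01].
have -> : 1 - 2^-1 = 2^-1 :> R by field.
rewrite !exprS !expr0 subr0 subrr => FE; exists (1 - xi); lra.
Qed.

(** In the derivative of [G] the first derivatives of F cancel and a factor s splits off, leaving
    [G2]. Two uses of Rolle therefore suffice before [even_half_mean]. *)
Lemma trapezoid_error F : derivative_tower 4 F ->
  exists2 xi, 0 < xi < 1 &
    F 0%N 1 - F 0%N 0 - (F 1%N 1 + F 1%N 0) / 2 + F 3%N 0 / 12 =
    - (F 4%N xi / 24).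
Proof.
move=> FE; pose k := F 0%N 1 - F 0%N 0 - (F 1%N 1 + F 1%N 0) / 2.
pose G (s : R) := odd_half (F 0%N) s - s * even_half (F 1%N) s - 8 * k * s ^+ 3.
pose G2 (s : R) := odd_half (F 2%N) s + 24 * k * s.
pose G3 (s : R) := even_half (F 3%N) s + 24 * k.
have GE (s : R) : 0 <= s <= 2^-1 -> is_derive s 1 G (- (s * G2 s)).
  move=> s0h; have F0 := is_derive_odd_half (fun x => FE 0%N x isT) s0h.
  have F1 := is_derive_even_half (fun x => FE 1%N x isT) s0h.
  apply: (@is_derive_eq _ _ _ (odd_half (F 0%N) - id * even_half (F 1%N)
    - (8 * k) *: id ^+ 3)).
  by rewrite /G2 /GRing.scale /=; ring.
have G2E (s : R) : 0 <= s <= 2^-1 -> is_derive s 1 G2 (G3 s).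
  move=> s0h; have F2 := is_derive_odd_half (fun x => FE 2%N x isT) s0h.
  have G2D : is_derive s 1 (odd_half (F 2%N) + (24 * k) *: (@id R))
      (even_half (F 3%N) s + (24 * k) *: 1) by exact: is_deriveD.
  by apply: (is_derive_eq G2D); rewrite /G3 /GRing.scale /= mulr1.
have hh : 2^-1 + 2^-1 = 1 :> R by field.
have [||s1 s1I /eqP] := @rolle G (fun s => - (s * G2 s)) 0 2^-1 _ GE; first lra.
  by rewrite /G /odd_half /even_half hh addr0 subrr subr0 /k; field.
(* The zero of s * [G2] s lies inside the interval, so it is a zero of [G2]. *)
have s1_neq0 : s1 != 0 by apply/eqP; lra.
rewrite oppr_eq0 mulf_eq0 (negPf s1_neq0) /= => /eqP G2s1.
have [|x||s2 s2I G3s2] := @rolle G2 G3 0 s1; first lra.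
- by move=> xs1; apply: G2E; lra.
- by rewrite G2s1 /G2 /odd_half addr0 subr0; ring.
have [|xi xi01 F4] := @even_half_mean _ _ s2 (fun x => FE 3%N x isT); first lra.
by exists xi => //; rewrite -/k -F4; move: G3s2; rewrite /G3; lra.
Qed.

Lemma trapezoid_error_reflect F : derivative_tower 4 F ->
  exists2 xi, 0 < xi < 1 &
    F 0%N 1 - F 0%N 0 - (F 1%N 1 + F 1%N 0) / 2 + F 3%N 1 / 12 = F 4%N xi / 24.
Proof.
move=> /derivative_tower_reflect/trapezoid_error[xi xi01].
rewrite !exprS !expr0 subr0 subrr => FE; exists (1 - xi); lra.
Qed.

End TaylorOnUnitInterval.

(** * The Euclidean inner product *)

Section EuclideanDot.
Variables (R : realType) (k : nat).
Implicit Types (u v w : 'rV[R]_k).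

Lemma dotvC u v : dotv u v = dotv v u.
Proof. by apply: eq_bigr => i _; rewrite mulrC. Qed.

Lemma dotvDl u v w : dotv (u + v) w = dotv u w + dotv v w.
Proof. by rewrite -big_split; apply: eq_bigr => i _; rewrite mxE mulrDl. Qed.

Lemma dotvZl a u v : dotv (a *: u) v = a * dotv u v.
Proof.
by rewrite /dotv mulr_sumr; apply: eq_bigr => i _; rewrite mxE mulrA.
Qed.

Lemma dotvNl u v : dotv (- u) v = - dotv u v.
Proof. by rewrite -scaleN1r dotvZl mulN1r. Qed.

Lemma dotv0l u : dotv 0 u = 0.
Proof. by rewrite -(scale0r 0) dotvZl mul0r. Qed.

Lemma dotvDr u v w : dotv w (u + v) = dotv w u + dotv w v.
Proof. by rewrite dotvC dotvDl !(dotvC w). Qed.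

Lemma dotvZr a u v : dotv v (a *: u) = a * dotv v u.
Proof. by rewrite dotvC dotvZl (dotvC v). Qed.

Lemma dotvNr u v : dotv v (- u) = - dotv v u.
Proof. by rewrite dotvC dotvNl (dotvC v). Qed.

Lemma dotv_suml (I : finType) (P : pred I) (f : I -> 'rV[R]_k) v :
  dotv (\sum_(i | P i) f i) v = \sum_(i | P i) dotv (f i) v.
Proof.
by elim/big_rec2: _ => [|i x y _ <-]; rewrite ?dotv0l ?dotvDl.
Qed.

Lemma dotv_sumr (I : finType) (P : pred I) (f : I -> 'rV[R]_k) v :
  dotv v (\sum_(i | P i) f i) = \sum_(i | P i) dotv v (f i).
Proof. by rewrite dotvC dotv_suml; apply: eq_bigr => i _; rewrite dotvC. Qed.

Lemma enorm_sq u : enorm u ^+ 2 = dotv u u.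
Proof.
by rewrite sqr_sqrtr //; apply: sumr_ge0 => i _; rewrite -expr2 sqr_ge0.
Qed.

(** The mixed terms cancel by symmetry. With u and v the old and new separations, this produces the
    increment of the squared distance. *)
Lemma dotv_mean_diff u v :
  dotv (2^-1 *: (u + v)) (v - u) = 2^-1 * (enorm v ^+ 2 - enorm u ^+ 2).
Proof.
rewrite dotvZl dotvDl !dotvDr !dotvNr !enorm_sq (dotvC u v).
by congr (_ * _); ring.
Qed.

End EuclideanDot.

(** * Sums over pairs of distinct particles *)

Section PairSum.
Variables (R : realType) (N : nat).
Implicit Types f g : 'I_N -> 'I_N -> R.

(** The factor 1/2 compensates for the two orderings of each pair; [potential] has this shape by
    conversion. *)
Definition pair_sum f : R := 2^-1 * \sum_(A < N) \sum_(B < N | B != A) f A B.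

Lemma eq_pair_sum f g :
  (forall A B, A != B -> f A B = g A B) -> pair_sum f = pair_sum g.
Proof.
move=> fg; congr (_ * _); apply: eq_bigr => A _; apply: eq_bigr => B BA.
by rewrite fg // eq_sym.
Qed.

Lemma pair_sumD f g :
  pair_sum (fun A B => f A B + g A B) = pair_sum f + pair_sum g.
Proof.
rewrite -mulrDr -big_split; congr (_ * _); apply: eq_bigr => A _.
by rewrite big_split.
Qed.

Lemma pair_sumZ f a : pair_sum (fun A B => a * f A B) = a * pair_sum f.
Proof.
rewrite mulrCA; congr (_ * _); rewrite mulr_sumr; apply: eq_bigr => A _.
by rewrite mulr_sumr.
Qed.

Lemma pair_sumN f : pair_sum (fun A B => - f A B) = - pair_sum f.
Proof.
by rewrite -mulN1r -pair_sumZ; apply: eq_pair_sum => A B _; rewrite mulN1r.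
Qed.

Lemma pair_sum_midpoint f1 f0 g h a :
  pair_sum f1 - pair_sum f0 - pair_sum g - pair_sum h / a =
  pair_sum (fun A B => f1 A B - f0 A B - g A B - h A B / a).
Proof.
rewrite mulrC -pair_sumZ -!pair_sumN -!pair_sumD.
by apply: eq_pair_sum => A B _; rewrite mulrC.
Qed.

Lemma pair_sum_trapezoid f1 f0 g1 g0 h a b :
  pair_sum f1 - pair_sum f0 - (pair_sum g1 + pair_sum g0) / a
    + pair_sum h / b =
  pair_sum (fun A B =>
    f1 A B - f0 A B - (g1 A B + g0 A B) / a + h A B / b).
Proof.
rewrite -pair_sumD (mulrC _ a^-1) (mulrC _ b^-1).
rewrite -!pair_sumZ -!pair_sumN -!pair_sumD.
by apply: eq_pair_sum => A B _; rewrite (mulrC _ a^-1) (mulrC _ b^-1).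
Qed.

Lemma pair_sum_ge0 f :
  (forall A B, A != B -> 0 <= f A B) -> 0 <= pair_sum f.
Proof.
move=> f0; apply: mulr_ge0; rewrite ?invr_ge0 //.
by apply: sumr_ge0 => A _; apply: sumr_ge0 => B BA; rewrite f0 // eq_sym.
Qed.

Lemma pair_sumC f : pair_sum (fun A B => f B A) = pair_sum f.
Proof.
congr (_ * _); rewrite (exchange_big_dep xpredT) //=; apply: eq_bigr => A _.
by apply: eq_bigl => B; rewrite eq_sym.
Qed.

End PairSum.

(** * Energy balance of one step *)

Section EnergyBalance.
Variables (R : realType) (N : nat).
Implicit Types (m : 'M[R]_N) (q p : particles R N) (c : 'I_N -> 'I_N -> R).

Lemma kinetic_diff m p p' : m^T = m ->
  kinetic m p' - kinetic m p =
  \sum_(A < N) dotv (p' A - p A) (\sum_(B < N) invmx m A B *: midpt p p' B).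
Proof.
move=> mT; have wC A B : invmx m A B = invmx m B A.
  by rewrite -[in LHS]mT -trmx_inv mxE.
pose cross A B := invmx m A B * dotv (p' A) (p B).
have crossC : \sum_(A < N) \sum_(B < N) cross A B =
    \sum_(A < N) \sum_(B < N) invmx m A B * dotv (p A) (p' B).
  rewrite exchange_big; apply: eq_bigr => A _; apply: eq_bigr => B _.
  by rewrite /cross wC dotvC.
(* The inserted mixed terms cancel in the double sum because the inverse mass matrix is symmetric;
   with them each summand factors as an increment of p times a sum of p and p'. *)
transitivity (2^-1 * (\sum_(A < N) \sum_(B < N)
    (invmx m A B * dotv (p' A) (p' B) - invmx m A B * dotv (p A) (p B)
     + (cross A B - invmx m A B * dotv (p A) (p' B))))).
  rewrite -mulrBr -sumrB; congr (_ * _).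
  under [RHS]eq_bigr do rewrite big_split /= !sumrB.
  by rewrite [RHS]big_split /= [X in _ = _ + X]sumrB crossC subrr addr0.
rewrite mulr_sumr; apply: eq_bigr => A _; rewrite mulr_sumr dotv_sumr.
apply: eq_bigr => B _; rewrite /cross /midpt.
by rewrite !(dotvZr, dotvDl, dotvNl, dotvDr); ring.
Qed.

Lemma distC q A B : dist q A B = dist q B A.
Proof. by rewrite /dist /enorm -opprB dotvNl dotvNr opprK. Qed.

Lemma pair_force_antisym dt c q q' A B : c A B = c B A ->
  pair_force dt (c A B) q q' A B = - pair_force dt (c B A) q q' B A.
Proof.
move=> ->; rewrite /pair_force (distC q A) (distC q' A).
rewrite -[in RHS](opprB (midpt q q' A)).
by rewrite !scalerN opprK.
Qed.

(** The midpoint separation is the mean of the old and new ones, so [dotv_mean_diff] yields (d'^2 -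
    d^2) / 2, from which the positive denominator d' + d cancels. *)
Lemma pair_force_work dt a q q' A B : 0 < dist q A B -> 0 < dist q' A B ->
  dotv (pair_force dt a q q' A B) ((q' A - q A) - (q' B - q B)) =
  dt * (a * (dist q' A B - dist q A B)).
Proof.
move=> d0 d'0; rewrite /pair_force !dotvZl.
have -> : midpt q q' A - midpt q q' B =
    2^-1 *: ((q A - q B) + (q' A - q' B)).
  by rewrite -scalerBr opprD addrACA.
have -> : (q' A - q A) - (q' B - q B) = (q' A - q' B) - (q A - q B).
  by rewrite !opprB addrACA [RHS]addrACA [- q A + _]addrC.
rewrite dotv_mean_diff -/(dist q A B) -/(dist q' A B).
have : dist q' A B + dist q A B != 0 by rewrite gt_eqF // addr_gt0.
by move=> ?; field.
Qed.

(** Keeping [c] arbitrary but symmetric lets one balance serve all four integrators. *)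
Lemma hamiltonian_diff m dt (V : pair_potentials R N) c q p q' p'
    (F : 'I_N -> 'I_N -> 'rV[R]_3) :
  m^T = m -> 0 < dt ->
  (forall A B, A != B -> 0 < dist q A B) ->
  (forall A B, A != B -> 0 < dist q' A B) ->
  (forall A B, A != B -> c A B = c B A) ->
  (forall A B, F A B = pair_force dt (c A B) q q' A B) ->
  solves_step m dt F q p q' p' ->
  hamiltonian m V q' p' - hamiltonian m V q p =
  pair_sum (fun A B => V A B (dist q' A B) - V A B (dist q A B)
                       - c A B * (dist q' A B - dist q A B)).
Proof.
move=> mT dt0 d0 d'0 cC FE step.
pose work A B := dotv (F A B) (q' A - q A).
have pair_work A B : A != B ->
    work A B + work B A = dt * (c A B * (dist q' A B - dist q A B)).
  move=> AB; rewrite -pair_force_work ?d0 ?d'0 // [in RHS]dotvDr dotvNr /work.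
  congr (_ + _); first by rewrite FE.
  by rewrite FE pair_force_antisym ?dotvNl // cC // eq_sym.
(* Multiplication by [dt] turns the velocity in [kinetic_diff] into the increment of q, by the first
   update equation; [dt] is cancelled afterwards. *)
have workE : dt * (kinetic m p' - kinetic m p) = - (2 * pair_sum work).
  rewrite (kinetic_diff _ _ mT) mulr_sumr /pair_sum mulrA divff ?pnatr_eq0 //.
  rewrite mul1r -sumrN; apply: eq_bigr => A _; have [qA pA] := step A.
  by rewrite -dotvZr -qA pA dotvNl dotv_suml.
have kineticE : kinetic m p' - kinetic m p =
    - pair_sum (fun A B => c A B * (dist q' A B - dist q A B)).
  apply: (mulfI (lt0r_neq0 dt0)).
  (* The doubled sum is split into two copies, one of them with A and B exchanged, so that
     [pair_work] applies to each summand. *)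
  rewrite workE mulrN -[in RHS]pair_sumZ mulr_natl mulr2n.
  rewrite -{2}pair_sumC -pair_sumD; congr (- _).
  exact: eq_pair_sum.
rewrite !pair_sumD !pair_sumN -kineticE /hamiltonian /potential -!/(pair_sum _).
by ring.
Qed.

End EnergyBalance.

(** * Potential energy along interpolated distances *)

Section PotentialsAlongStep.
Variables (R : realType) (N : nat).
Implicit Types (W : pair_potentials R N) (q : particles R N).

(** Derivatives are local and (0, oo) is open, so identities known only for positive distances, such
    as symmetry and splitting, pass to derivatives. *)
Lemma eq_derive1n_pos (f g : R -> R) : (forall r, 0 < r -> f r = g r) ->
  forall j r, 0 < r -> derive1n j f r = derive1n j g r.
Proof.
move=> fg; elim=> [|j IHj] r r0; first exact: fg.
rewrite !derive1nS !derive1E; apply: near_eq_derive.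
by apply: filterS (lt_nbhsr r0) => x; exact: IHj.
Qed.

Lemma pair_symmetric_derive1n W j r A B : pair_symmetric W -> A != B ->
  0 < r -> derive1n j (W A B) r = derive1n j (W B A) r.
Proof. by move=> WC AB; apply: eq_derive1n_pos => s s0; exact: WC. Qed.

Lemma splits_as_derive1 W W1 W2 r A B : splits_as W W1 W2 ->
  times_differentiable 1 (W1 A B) -> times_differentiable 1 (W2 A B) ->
  A != B -> 0 < r ->
  derive1 (W A B) r = derive1 (W1 A B) r + derive1 (W2 A B) r.
Proof.
move=> WE dW1 dW2 AB r0.
have dW1r : derivable (W1 A B) r 1 := dW1 0%N r isT r0.
have dW2r : derivable (W2 A B) r 1 := dW2 0%N r isT r0.
transitivity (derive1 (W1 A B + W2 A B) r).
  by rewrite -!derive1n1; apply: eq_derive1n_pos => // s s0; exact: WE.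
by rewrite !derive1E; exact: deriveD.
Qed.

Lemma is_derive_bigsum (I : Type) (s : seq I) (P : pred I) (f : I -> R -> R)
    (df : I -> R) (x : R) :
  (forall i, P i -> is_derive x 1 (f i) (df i)) ->
  is_derive x 1 (fun y => \sum_(i <- s | P i) f i y) (\sum_(i <- s | P i) df i).
Proof.
move=> fE; have -> : (fun y => \sum_(i <- s | P i) f i y) =
    \sum_(i <- s | P i) f i by apply/funext => y; rewrite fct_sumE.
elim/big_rec2: _ => [|i a b Pi bE]; first exact: is_derive_cst.
by have := fE i Pi => fiE; exact: is_deriveD.
Qed.

Lemma is_derive_pair_sum (f : 'I_N -> 'I_N -> R -> R)
    (df : 'I_N -> 'I_N -> R) (x : R) :
  (forall A B, A != B -> is_derive x 1 (f A B) (df A B)) ->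
  is_derive x 1 (fun y => pair_sum (fun A B => f A B y)) (pair_sum df).
Proof.
move=> fE; have sumE : is_derive x 1
    (fun y => \sum_(A < N) \sum_(B < N | B != A) f A B y)
    (\sum_(A < N) \sum_(B < N | B != A) df A B).
  apply: is_derive_bigsum => A _; apply: is_derive_bigsum => B BA.
  by apply: fE; rewrite eq_sym.
exact: (@is_derive_eq _ _ _
  (2^-1 *: (fun y => \sum_(A < N) \sum_(B < N | B != A) f A B y))).
Qed.

(* The j-th derivative of the total potential energy when the pair distances,
   rather than the positions, are interpolated affinely. *)
Definition energy_along W q q' (j : nat) (alpha : R) : R :=
  pair_sum (fun A B => (dist q' A B - dist q A B) ^+ j *
                       derive1n j (W A B) (dist_at q q' A B alpha)).

Lemma dist_at_gt0 q q' A B alpha : 0 < dist q A B -> 0 < dist q' A B ->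
  0 <= alpha <= 1 -> 0 < dist_at q q' A B alpha.
Proof. by rewrite /dist_at; nra. Qed.

Lemma dist_at0 q q' A B : dist_at q q' A B 0 = dist q A B.
Proof. by rewrite /dist_at; ring. Qed.

Lemma dist_at1 q q' A B : dist_at q q' A B 1 = dist q' A B.
Proof. by rewrite /dist_at; ring. Qed.

Lemma dist_at_half q q' A B :
  dist_at q q' A B 2^-1 = (dist q' A B + dist q A B) / 2.
Proof. by rewrite /dist_at; field. Qed.

(** Chain rule: each differentiation in alpha releases one factor d' - d. Interpolated distances
    stay positive on [0, 1], endpoints included. *)
Lemma energy_along_tower k W q q' :
  (forall A B, A != B -> 0 < dist q A B) ->
  (forall A B, A != B -> 0 < dist q' A B) ->
  (forall A B, A != B -> times_differentiable k (W A B)) ->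
  derivative_tower k (energy_along W q q').
Proof.
move=> d0 d'0 dW j x jk x01; apply: is_derive_pair_sum => A B AB.
set d := dist q A B; set d' := dist q' A B.
have dist_atE y : dist_at q q' A B y = d + (d' - d) * y.
  by rewrite /dist_at -/d -/d'; ring.
have x_gt0 : 0 < d + (d' - d) * x.
  by rewrite -dist_atE dist_at_gt0 ?d0 ?d'0.
have WE : is_derive (d + (d' - d) * x) 1 (derive1n j (W A B))
    (derive1n j.+1 (W A B) (d + (d' - d) * x)).
  by rewrite derive1nS derive1E; apply: derivableP; exact: dW.
have WE' := is_derive_affine WE.
under eq_fun do rewrite dist_atE.
apply: (@is_derive_eq _ _ _ ((d' - d) ^+ j *:
  (fun y => derive1n j (W A B) (d + (d' - d) * y)))).
by rewrite /GRing.scale /= dist_atE exprS; ring.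
Qed.

Lemma energy_alongB W1 W2 q q' j x y :
  energy_along W1 q q' j x - energy_along W2 q q' j y =
  pair_sum (fun A B => (dist q' A B - dist q A B) ^+ j *
    (derive1n j (W1 A B) (dist_at q q' A B x) -
     derive1n j (W2 A B) (dist_at q q' A B y))).
Proof.
rewrite -pair_sumN -pair_sumD; apply: eq_pair_sum => A B _.
by rewrite mulrBr.
Qed.

Lemma energy_alongB_ge0 W1 W2 q q' j x y : ~~ odd j ->
  (forall A B, A != B -> 0 < dist q A B) ->
  (forall A B, A != B -> 0 < dist q' A B) ->
  (forall A B (r : R), A != B -> 0 < r -> 0 <= derive1n j (W1 A B) r) ->
  (forall A B (r : R), A != B -> 0 < r -> derive1n j (W2 A B) r <= 0) ->
  0 < x < 1 -> 0 < y < 1 ->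
  0 <= energy_along W1 q q' j x - energy_along W2 q q' j y.
Proof.
move=> j_even d0 d'0 W1_ge0 W2_le0 /andP[x0 x1] /andP[y0 y1].
rewrite energy_alongB; apply: pair_sum_ge0 => A B AB.
rewrite mulr_ge0 ?exprn_even_ge0 // subr_ge0 (@le_trans _ _ 0) //.
  by rewrite W2_le0 // dist_at_gt0 ?d0 ?d'0 ?ltW.
by rewrite W1_ge0 // dist_at_gt0 ?d0 ?d'0 ?ltW.
Qed.

End PotentialsAlongStep.

(** * Energy laws of the four integrators *)

Lemma energy_drop (R : realType) (H H' D e1 e2 a b k : R) :
  H' - H = e1 + e2 -> e1 = - (a / k) -> e2 = b / k -> D = k^-1 * (a - b) ->
  H' = H - D.
Proof. by move=> HE e1E e2E DE; rewrite -[H'](subrK H) HE e1E e2E DE; ring. Qed.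

Theorem proposition8 (R : realType) (N : nat) (m : 'M[R]_N) (dt : R)
    (V Vc Ve Vp Vm : pair_potentials R N) (q p q' p' : particles R N)
    (m_posdef : posdefmx m)
    (dt_gt0 : 0 < dt)
    (V_sym : pair_symmetric V)
    (Vc_sym : pair_symmetric Vc) (Ve_sym : pair_symmetric Ve)
    (Vp_sym : pair_symmetric Vp) (Vm_sym : pair_symmetric Vm)
    (V_split_ce : splits_as V Vc Ve)
    (V_split_pm : splits_as V Vp Vm)
    (Vc_diff : forall A B, A != B -> times_differentiable 2 (Vc A B))
    (Ve_diff : forall A B, A != B -> times_differentiable 2 (Ve A B))
    (Vp_diff : forall A B, A != B -> times_differentiable 4 (Vp A B))
    (Vm_diff : forall A B, A != B -> times_differentiable 4 (Vm A B))
    (Vc_ge0 : forall A B (r : R), A != B -> 0 < r -> 0 <= derive1n 2 (Vc A B) r)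
    (Ve_le0 : forall A B (r : R), A != B -> 0 < r -> derive1n 2 (Ve A B) r <= 0)
    (Vp_ge0 : forall A B (r : R), A != B -> 0 < r -> 0 <= derive1n 4 (Vp A B) r)
    (Vm_le0 : forall A B (r : R), A != B -> 0 < r -> derive1n 4 (Vm A B) r <= 0)
    (d_gt0 : forall A B, A != B -> 0 < dist q A B)
    (d'_gt0 : forall A B, A != B -> 0 < dist q' A B) :
  [/\ (forall A B, A != B -> dist q' A B != dist q A B) ->
      solves_step m dt (force_lg dt V q q') q p q' p' ->
      hamiltonian m V q' p' = hamiltonian m V q p,

      solves_step m dt (force_ge dt Vc Ve q q') q p q' p' ->
      exists xi1 xi2 : R,
        [/\ 0 < xi1 < 1, 0 < xi2 < 1,
            hamiltonian m V q' p' =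
              hamiltonian m V q p - dissip_ge Vc Ve q q' xi1 xi2
          & 0 <= dissip_ge Vc Ve q q' xi1 xi2],

      solves_step m dt (force_pm dt V Vp Vm q q') q p q' p' ->
      exists xi3 xi4 : R,
        [/\ 0 < xi3 < 1, 0 < xi4 < 1,
            hamiltonian m V q' p' =
              hamiltonian m V q p - dissip_pm Vp Vm q q' xi3 xi4
          & 0 <= dissip_pm Vp Vm q q' xi3 xi4]

    & solves_step m dt (force_pt dt V Vp Vm q q') q p q' p' ->
      exists xi5 xi6 : R,
        [/\ 0 < xi5 < 1, 0 < xi6 < 1,
            hamiltonian m V q' p' =
              hamiltonian m V q p - dissip_pt Vp Vm q q' xi5 xi6
          & 0 <= dissip_pt Vp Vm q q' xi5 xi6]].
Proof.
have hamiltonianE := @hamiltonian_diff R N m dt V _ q p q' p' _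
  (proj1 m_posdef) dt_gt0 d_gt0 d'_gt0.
have dm_gt0 A B : A != B -> 0 < (dist q' A B + dist q A B) / 2.
  by move=> AB; rewrite divr_gt0 // addr_gt0 ?d_gt0 ?d'_gt0.
(* The forces [force_pm] and [force_pt] evaluate V' itself, while the remainders are taken for the
   two parts separately. *)
have V'E A B r : A != B -> 0 < r ->
    derive1 (V A B) r = derive1 (Vp A B) r + derive1 (Vm A B) r.
  move=> AB r0; apply: (splits_as_derive1 V_split_pm) => // j s.
    by rewrite ltnS leqn0 => /eqP-> s0; exact: Vp_diff.
  by rewrite ltnS leqn0 => /eqP-> s0; exact: Vm_diff.
have V'C A B r : A != B -> 0 < r -> derive1 (V A B) r = derive1 (V B A) r.
  by move=> AB r0; rewrite -!derive1n1; exact: pair_symmetric_derive1n.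
split.
- move=> d_neq step.
  apply/eqP; rewrite -subr_eq0; apply/eqP.
  (* The proof [erefl] makes unification read the scalar [c] off the definition of the force. *)
  rewrite (hamiltonianE _ _ _ (fun A B => erefl) step).
    (* The difference quotient times d' - d is the exact increment of the potential, so each summand
       is 0; the form [0 * 0] lets [pair_sumZ] evaluate the sum. *)
    rewrite (@eq_pair_sum _ _ _ (fun=> fun=> 0 * 0)) => [|A B AB].
      by rewrite pair_sumZ mul0r.
    by rewrite mul0r divfK ?subrr // subr_eq0 d_neq.
  move=> A B AB.
  by rewrite (distC q B) (distC q' B) !(V_sym _ _ _ AB) ?d_gt0 ?d'_gt0.
- move=> step.
  (* The force takes the convex part at d' and the concave part at d, hence expansions at alpha = 1
     and alpha = 0. Their remainders have opposite signs, matching those of the second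
     derivatives. *)
  have [xi1 xi1I c_err] :=
    taylor2_reflect (energy_along_tower d_gt0 d'_gt0 Vc_diff).
  have [xi2 xi2I e_err] := taylor2 (energy_along_tower d_gt0 d'_gt0 Ve_diff).
  (* One factor 1/2 of the 1/4 is already inside [pair_sum]. *)
  have dissipE : dissip_ge Vc Ve q q' xi1 xi2 =
      2^-1 * (energy_along Vc q q' 2 xi1 - energy_along Ve q q' 2 xi2).
    by rewrite energy_alongB /dissip_ge /pair_sum mulrA; congr (_ * _); field.
  exists xi1, xi2; split=> //; last first.
    by rewrite dissipE mulr_ge0 ?invr_ge0 // energy_alongB_ge0.
  suff : hamiltonian m V q' p' - hamiltonian m V q p =
      (energy_along Vc q q' 0 1 - energy_along Vc q q' 0 0
       - energy_along Vc q q' 1 1) +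
      (energy_along Ve q q' 0 1 - energy_along Ve q q' 0 0
       - energy_along Ve q q' 1 0).
    by move=> balance; exact: (energy_drop balance c_err e_err dissipE).
  rewrite (hamiltonianE _ _ _ (fun A B => erefl) step); last first.
    move=> A B AB; rewrite (distC q B) (distC q' B) -!derive1n1.
    by congr (_ + _); apply: pair_symmetric_derive1n; rewrite ?d_gt0 ?d'_gt0.
  rewrite /energy_along -!pair_sumN -!pair_sumD; apply: eq_pair_sum => A B AB.
  rewrite !dist_at0 !dist_at1 !V_split_ce ?d_gt0 ?d'_gt0 //.
  by rewrite !expr0 !expr1 !derive1n0 !derive1n1; ring.
- move=> step.
  have [xi3 xi3I p_err] :=
    midpoint_error_reflect (energy_along_tower d_gt0 d'_gt0 Vp_diff).
  have [xi4 xi4I m_err] :=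
    midpoint_error (energy_along_tower d_gt0 d'_gt0 Vm_diff).
  have dissipE : dissip_pm Vp Vm q q' xi3 xi4 =
      48^-1 * (energy_along Vp q q' 4 xi3 - energy_along Vm q q' 4 xi4).
    by rewrite energy_alongB /dissip_pm /pair_sum mulrA; congr (_ * _); field.
  exists xi3, xi4; split=> //; last first.
    by rewrite dissipE mulr_ge0 ?invr_ge0 // energy_alongB_ge0.
  (* The factor (d' - d)^2 / 24 of the force, times d' - d from the work, is the cubic correction;
     alpha = 1/2 is the mean distance. *)
  suff : hamiltonian m V q' p' - hamiltonian m V q p =
      (energy_along Vp q q' 0 1 - energy_along Vp q q' 0 0
       - energy_along Vp q q' 1 2^-1 - energy_along Vp q q' 3 1 / 24) +
      (energy_along Vm q q' 0 1 - energy_along Vm q q' 0 0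
       - energy_along Vm q q' 1 2^-1 - energy_along Vm q q' 3 0 / 24).
    by move=> balance; exact: (energy_drop balance p_err m_err dissipE).
  rewrite (hamiltonianE _ _ _ (fun A B => erefl) step); last first.
    move=> A B AB; rewrite (distC q B) (distC q' B).
    rewrite (V'C _ _ _ AB (dm_gt0 _ _ AB)).
    rewrite (pair_symmetric_derive1n 3 Vp_sym AB (d'_gt0 _ _ AB)).
    by rewrite (pair_symmetric_derive1n 3 Vm_sym AB (d_gt0 _ _ AB)).
  apply: (etrans _ (esym (congr2 +%R (pair_sum_midpoint _ _ _ _ _)
    (pair_sum_midpoint _ _ _ _ _)))).
  rewrite -[RHS]pair_sumD; apply: eq_pair_sum => A B AB.
  rewrite !dist_at0 !dist_at1 !dist_at_half !V_split_pm ?d_gt0 ?d'_gt0 //.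
  rewrite (V'E _ _ _ AB (dm_gt0 _ _ AB)) !expr0 !expr1 !derive1n0 !derive1n1.
  (* Derivative values become atoms, which leaves a rational identity for [field]. *)
  move: (derive1n 3 (Vp A B) _) (derive1n 3 (Vm A B) _) => p3 m3.
  move: (derive1 (Vp A B) _) (derive1 (Vm A B) _) => p1 m1.
  by move: (dist q A B) (dist q' A B) => d d'; field.
- move=> step.
  (* The trapezoidal remainder has the sign opposite to the midpoint one, so the endpoints of the
     third derivatives are exchanged. *)
  have [xi5 xi5I p_err] :=
    trapezoid_error (energy_along_tower d_gt0 d'_gt0 Vp_diff).
  have [xi6 xi6I m_err] :=
    trapezoid_error_reflect (energy_along_tower d_gt0 d'_gt0 Vm_diff).
  have dissipE : dissip_pt Vp Vm q q' xi5 xi6 =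
      24^-1 * (energy_along Vp q q' 4 xi5 - energy_along Vm q q' 4 xi6).
    by rewrite energy_alongB /dissip_pt /pair_sum mulrA; congr (_ * _); field.
  exists xi5, xi6; split=> //; last first.
    by rewrite dissipE mulr_ge0 ?invr_ge0 // energy_alongB_ge0.
  suff : hamiltonian m V q' p' - hamiltonian m V q p =
      (energy_along Vp q q' 0 1 - energy_along Vp q q' 0 0
       - (energy_along Vp q q' 1 1 + energy_along Vp q q' 1 0) / 2
       + energy_along Vp q q' 3 0 / 12) +
      (energy_along Vm q q' 0 1 - energy_along Vm q q' 0 0
       - (energy_along Vm q q' 1 1 + energy_along Vm q q' 1 0) / 2
       + energy_along Vm q q' 3 1 / 12).
    by move=> balance; exact: (energy_drop balance p_err m_err dissipE).
  rewrite (hamiltonianE _ _ _ (fun A B => erefl) step); last first.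
    move=> A B AB; rewrite (distC q B) (distC q' B).
    rewrite (V'C _ _ _ AB (d_gt0 _ _ AB)) (V'C _ _ _ AB (d'_gt0 _ _ AB)).
    rewrite (pair_symmetric_derive1n 3 Vp_sym AB (d_gt0 _ _ AB)).
    by rewrite (pair_symmetric_derive1n 3 Vm_sym AB (d'_gt0 _ _ AB)).
  apply: (etrans _ (esym (congr2 +%R (pair_sum_trapezoid _ _ _ _ _ _ _)
    (pair_sum_trapezoid _ _ _ _ _ _ _)))).
  rewrite -[RHS]pair_sumD; apply: eq_pair_sum => A B AB.
  rewrite !dist_at0 !dist_at1 !V_split_pm ?d_gt0 ?d'_gt0 //.
  rewrite (V'E _ _ _ AB (d_gt0 _ _ AB)) (V'E _ _ _ AB (d'_gt0 _ _ AB)).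
  rewrite !expr0 !expr1 !derive1n0 !derive1n1.
  move: (derive1n 3 (Vp A B) _) (derive1n 3 (Vm A B) _) => p3 m3.
  move: (derive1 (Vp A B) _) (derive1 (Vm A B) _) => p1 m1.
  move: (derive1 (Vp A B) _) (derive1 (Vm A B) _) => p1' m1'.
  by move: (dist q A B) (dist q' A B) => d d'; field.
Qed.
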